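(* There exists a constant $N>0$ such that $$\left(\int_{-a}^{a}\int_0^b\frac{|\psi(\boldsymbol{x})|^2}{x_2^3}\,dx_2\,dx_1\right)^{1/2}\le N\,b^{1/2}\,\|\boldsymbol{v}\|_{L^2([-a,a]\times[0,b],\,x_2^{-2})}$$ for any $a>0$, $b>0$, and $\boldsymbol{v}=(v_1,v_2)\in\dot H^1_{0,\sigma}(\mathbb{R}^2_+)$, where $\psi$ is the stream function associated with $\boldsymbol{v}$.
   Context: Let $\mathbb{R}^2_+=\{\boldsymbol{x}=(x_1,x_2)\in\mathbb{R}^2: x_2>0\}$. Let $C^\infty_{c,\sigma}(\mathbb{R}^2_+)$ be the set of compactly supported smooth vector fields $\boldsymbol{\varphi}:\mathbb{R}^2_+\to\mathbb{R}^2$ with $\nabla\cdot\boldsymbol{\varphi}=0$. The homogeneous Sobolev space is $\dot H^1(\mathbb{R}^2_+)=\{u\in L^1_{\mathrm{loc}}(\mathbb{R}^2_+):\nabla u\in L^2(\mathbb{R}^2_+)\}$ with semi-norm $\|\nabla u\|_{L^2(\mathbb{R}^2_+)}$. $\dot H^1_{0,\sigma}(\mathbb{R}^2_+)$ denotes the completion of $C^\infty_{c,\sigma}(\mathbb{R}^2_+)$ in $\dot H^1(\mathbb{R}^2_+)\times\dot H^1(\mathbb{R}^2_+)$; by Hardy's inequality the semi-norm is a norm on it, and its elements are identified with functions (limits $\boldsymbol v$ of sequences $\boldsymbol\varphi_k\in C^\infty_{c,\sigma}(\mathbb{R}^2_+)$ with $\nabla\boldsymbol\varphi_k\to\nabla\boldsymbol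 v$ in $L^2$ and $\boldsymbol\varphi_k\to\boldsymbol v$ in $L^2_{\mathrm{loc}}$). For $\boldsymbol{v}=(v_1,v_2)\in\dot H^1_{0,\sigma}(\mathbb{R}^2_+)$ the associated stream function is $\psi(\boldsymbol{x})=\int_\Gamma(v_2\,dx-v_1\,dy)$, where $\Gamma$ is a continuous curve connecting $(0,0)$ and $\boldsymbol{x}=(x_1,x_2)$; since $\nabla\cdot\boldsymbol{v}=0$, $\psi$ is independent of the choice of $\Gamma$ and $\nabla^\perp\psi=(-\partial_2\psi,\partial_1\psi)=\boldsymbol{v}$ in $\mathbb{R}^2_+$. (For non-smooth $\boldsymbol v$: $\psi$ is the continuous function on $\overline{\mathbb{R}^2_+}$ with $\nabla^\perp\psi=\boldsymbol{v}$ and $\psi(0,0)=0$.) For a set $\mathcal D$ and weight $\mu$, $\|f\|_{L^2(\mathcal D,\mu)}=\big(\int_{\mathcal D}|f(\boldsymbol{x})|^2\mu(\boldsymbol{x})\,d\boldsymbol{x}\big)^{1/2}$. *)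

(* Defs.v *)
From mathcomp Require Import all_boot all_order all_algebra.
From mathcomp Require Import all_classical all_reals all_analysis.

Set Implicit Arguments.
Unset Strict Implicit.
Unset Printing Implicit Defensive.

Import Order.TTheory GRing.Theory Num.Theory.
Import numFieldNormedType.Exports.

Local Open Scope classical_set_scope.
Local Open Scope ring_scope.

Section HalfPlane.
Context {R : realType}.

Definition half_plane : set (R * R) := [set x | 0 < x.2].
Definition closed_half_plane : set (R * R) := [set x | 0 <= x.2].

(* Borel measurable plane, with the display of the product Lebesgue measure. *)
Local Notation plane := (measurableTypeR R * measurableTypeR R)%type.
Local Notation mu2 := (@lebesgue_measure R \x @lebesgue_measure R)%E.

Definition e1 : R * R := (1, 0).
Definition e2 : R * R := (0, 1).

(* The library norm on R * R is the sup norm; this is the Euclidean one. *)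
Definition enorm (z : R * R) : R := Num.sqrt (z.1 ^+ 2 + z.2 ^+ 2).

(* ||f||_{L^2(D, w)} for a scalar f, with values in [0, +oo]. *)
Definition wL2norm (D : set (R * R)) (w f : R * R -> R) : \bar R :=
  ((\int[mu2]_(x in D) (`|f x| ^+ 2 * w x)%:E) `^ 2^-1)%E.

Definition L2 (D : set (R * R)) (f : R * R -> R) : Prop :=
  measurable_fun (D : set plane) f /\ (wL2norm D (fun=> 1%R) f < +oo)%E.

Definition L1loc (f : R * R -> R) : Prop :=
  forall K, compact K -> K `<=` half_plane -> mu2.-integrable K (EFin \o f).

Definition partial (i : bool) (f : R * R -> R) : R * R -> R :=
  'D_(if i then e2 else e1) f.

(* C^oo: the iterated partial derivatives of all orders, taken in any order of
   the variables, exist and are continuous. *)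
Definition smooth (f : R * R -> R) : Prop :=
  forall s : seq bool, let g := foldr partial f s in
    continuous g /\ forall x, derivable g x e1 /\ derivable g x e2.

(* C_c^oo of the half plane, its elements being extended by 0 to R^2. *)
Definition Cc_infty (f : R * R -> R) : Prop :=
  smooth f /\
  exists K, [/\ compact K, K `<=` half_plane & forall x, ~ K x -> f x = 0].

Definition Cc_infty_sigma (phi : R * R -> R * R) : Prop :=
  [/\ Cc_infty (fst \o phi), Cc_infty (snd \o phi) &
      forall x, 'D_e1 (fst \o phi) x + 'D_e2 (snd \o phi) x = 0].

(* g is the distributional gradient of u in the (open) half plane. *)
Definition weak_gradient (u : R * R -> R) (g : R * R -> R * R) : Prop :=
  forall eta, Cc_infty eta ->
    (\int[mu2]_(x in half_plane) (u x * 'D_e1 eta x)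
       = - \int[mu2]_(x in half_plane) ((g x).1 * eta x)) /\
    (\int[mu2]_(x in half_plane) (u x * 'D_e2 eta x)
       = - \int[mu2]_(x in half_plane) ((g x).2 * eta x)).

(* u belongs to \dot H^1 of the half plane, with gradient g. *)
Definition H1dot_grad (u : R * R -> R) (g : R * R -> R * R) : Prop :=
  [/\ L1loc u, weak_gradient u g,
      L2 half_plane (fst \o g) & L2 half_plane (snd \o g)].

Definition grad (f : R * R -> R) (x : R * R) : R * R := ('D_e1 f x, 'D_e2 f x).

Definition H1dot_0sigma (v : R * R -> R * R) : Prop :=
  exists g1 g2 : R * R -> R * R,
  [/\ H1dot_grad (fst \o v) g1, H1dot_grad (snd \o v) g2 &
      exists phi : nat -> R * R -> R * R,
      [/\ forall k, Cc_infty_sigma (phi k),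
          wL2norm half_plane (fun=> 1)
            (fun x => enorm (grad (fst \o phi k) x - g1 x)) @[k --> \oo] --> 0%E,
          wL2norm half_plane (fun=> 1)
            (fun x => enorm (grad (snd \o phi k) x - g2 x)) @[k --> \oo] --> 0%E &
          forall K, compact K -> K `<=` half_plane ->
            wL2norm K (fun=> 1) (fun x => enorm (phi k x - v x)) @[k --> \oo]
              --> 0%E]].

(* perp-gradient (- d_2 psi, d_1 psi) = v, i.e. gradient (v_2, - v_1). *)
Definition stream_function (v : R * R -> R * R) (psi : R * R -> R) : Prop :=
  [/\ {within closed_half_plane, continuous psi},
      weak_gradient psi (fun x => ((v x).2, - (v x).1)) &
      psi (0, 0) = 0].

End HalfPlane.

(* Main.v *)
Require Import Defs.
From mathcomp Require Import all_boot all_order all_algebra.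
From mathcomp Require Import all_classical all_reals all_analysis.
From mathcomp Require Import measurable_realfun ring lra.

Import Order.TTheory GRing.Theory Num.Theory.
Import numFieldNormedType.Exports.

Local Open Scope classical_set_scope.
Local Open Scope ring_scope.

(** On a vertical segment the estimate is one application of Cauchy-Schwarz.
    If [psi] vanishes at [(t, 0)] then [psi (t, y)] is, up to sign, the integral
    of [v_1 (t, s) = s * (v_1 (t, s) / s)] over [0 < s < y], whence
    [psi (t, y) ^ 2 <= y ^ 3 / 3 * m t] where [m t] is the integral of
    [|v (t, s)| ^ 2 / s ^ 2] over [0 < s < b].  Dividing by [y ^ 3] and
    integrating over the box costs a factor [b] and turns [m] into the square of
    the right-hand side.

    What takes work is that [psi] is tied to [v] by distributional derivatives
    only.  One may assume that the weighted norm of [v] over the box is finite.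
    Two families of test functions [f x_1 * g x_2], built from a smooth step
    and its derivative rescaled to width [h], give what is needed, since one of
    their partial derivatives is a difference of two approximate Dirac masses:
    - with masses at [(0, 0)] and [(t, 0)] ([horizontal_estimate]), the pairing
      with [v_2] is [O (h ^ (1/2))], because the weight [x_2 ^ -2] is of order
      [h ^ -2] on the support; as [psi (0, 0) = 0], [psi] vanishes on the axis
      ([stream_axis0]);
    - with masses at [(t, 0)] and [(t, y)] ([vertical_estimate]), the square of
      the pairing with [v_1] is at most a constant times [(y + 2 * h) ^ 3] times
      the mean of [m] over [t, t + h]; that mean tends to [m t] at almost every
      [t], by Lebesgue differentiation ([stream_pointwise]).
    Approximate Dirac masses converge against [psi] by continuity
    ([delta_cvg]), and both pairings are bounded by [weighted_CauchySchwarz].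
    The constant [N] is a bound of the mollifier, that is, of the derivative of
    the smooth step, as this is what bounds the test functions. *)

Set Implicit Arguments.
Unset Strict Implicit.
Unset Printing Implicit Defensive.

(** * A smooth step on the line *)

Section OneDim.
Context {R : realType}.
Implicit Types (f g : R -> R) (P : {poly R}).

(** For [P = 1] this is the classical smooth function that is flat at 0.  The
    polynomial factor makes the family stable under derivation. *)
Definition flat P (x : R) : R := if 0 < x then P.[x^-1] * expR (- x^-1) else 0.

(** Functions closed under the operations from which the step is built.  Unlike
    the class of all smooth functions, this one is seen to be stable under
    derivation by a plain induction ([elementary_derive]), without any formula
    for higher derivatives of products or inverses. *)
Inductive elementary : (R -> R) -> Prop :=
| elementary_cst c : elementary (fun=> c)
| elementary_flat P : elementary (flat P)
| elementary_affine s c f : elementary f -> elementary (fun x => f (s * x + c))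
| elementary_add f g : elementary f -> elementary g ->
    elementary (fun x => f x + g x)
| elementary_mul f g : elementary f -> elementary g ->
    elementary (fun x => f x * g x)
| elementary_inv f : (forall x, f x != 0) -> elementary f ->
    elementary (fun x => (f x)^-1).

Definition flat_deriv P : {poly R} := 'X ^+ 2 * (P - P^`()).

Lemma pow_expR_bound n (x : R) : 0 < x -> x ^+ n * expR (- x) <= n.+1`!%:R / x.
Proof.
move=> x0; have := expR_ge1Dxn n (ltW x0).
rewrite expRN -ler_pdivlMr ?invr_gt0 ?expR_gt0// invrK => h.
rewrite mulrAC ler_pdivlMr// -exprSr.
have : x ^+ n.+1 / n.+1`!%:R <= expR x by apply: le_trans h; rewrite lerDr.
by rewrite ler_pdivrMr ?ltr0n ?fact_gt0// mulrC.
Qed.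

(** Exponential decay beats every polynomial.  At the point [h^-1], and for
    [P * 'X] in place of [P], this bounds the difference quotient of [flat P] at
    0 by a multiple of [h]. *)
Lemma poly_expR_bound P : exists C : R, 0 <= C /\
  forall x, 0 < x -> `|P.[x] * expR (- x)| <= C / x.
Proof.
exists (\sum_(i < size P) `|P`_i| * i.+1`!%:R); split.
  by apply: sumr_ge0 => i _; rewrite mulr_ge0.
move=> x x0; rewrite horner_coef !mulr_suml; apply: le_trans (ler_norm_sum _ _ _) _.
apply: ler_sum => i _; rewrite -!mulrA normrM ler_wpM2l//.
rewrite ger0_norm; first exact: pow_expR_bound.
by rewrite mulr_ge0// ?exprn_ge0 ?expR_ge0// ltW.
Qed.

Lemma is_derive_near_cst f (c x : R) : (\near x, f x = c) -> is_derive x 1 f 0.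
Proof.
move=> fc; have E : \near x, cst c x = f x by near=> y; apply/esym; near: y.
exact: (@near_eq_is_derive _ _ _ _ _ _ _ _ E (is_derive_cst _ _ _)).
Unshelve. all: by end_near.
Qed.

Lemma is_derive_flat_pos P (x : R) : 0 < x ->
  is_derive x 1 (flat P) (flat (flat_deriv P) x).
Proof.
move=> x0; have xN0 : x != 0 by rewrite gt_eqF.
have flatE : \near x, P.[x^-1] * expR (- x^-1) = flat P x.
  by near=> y; rewrite /flat ifT//; near: y; exact: lt_nbhsr.
apply: (near_eq_is_derive flatE).
have dV : is_derive x 1 (fun y : R => y^-1) (- x ^- 2 *: (1:R)).
  exact: is_deriveV.
have dP : is_derive x 1 (fun y : R => P.[y^-1]) (P^`().[x^-1] * (- x ^- 2 *: (1:R))).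
  exact: (@is_derive1_comp _ (horner P) (fun y => y^-1)).
have dE : is_derive x 1 (fun y : R => expR (- y^-1)) (expR (- x^-1) * (x ^- 2)).
  apply: (@is_derive1_comp _ expR (fun y => - y^-1)).
  by apply: is_derive_eq; rewrite scaleNr opprK /GRing.scale /= mulr1.
apply: is_derive_eq.
rewrite /flat x0 /flat_deriv !hornerE /GRing.scale /=.
by field.
Unshelve. all: by end_near.
Qed.

Lemma is_derive_flat P (x : R) : is_derive x 1 (flat P) (flat (flat_deriv P) x).
Proof.
have [x0|x0|<-] := ltgtP 0 x; first exact: is_derive_flat_pos.
- rewrite {2}/flat (lt_gtF x0).
  apply: (@is_derive_near_cst _ 0).
  by near=> y; rewrite /flat ifF//; apply: lt_gtF; near: y; exact: lt_nbhsl.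
rewrite {2}/flat ltxx.
have [C [C0 HC]] := poly_expR_bound (P * 'X).
suff H : h^-1 *: (flat P (h *: (1:R) + 0) - flat P 0) @[h --> 0^'] --> (0:R).
  by apply: DeriveDef; [apply/cvg_ex; exists 0|apply/cvg_lim].
rewrite {2}/flat ltxx.
have bound (h : R) : `|h^-1 *: (flat P (h *: (1:R) + 0) - 0)| <= C * `|h|.
  rewrite subr0 addr0 /GRing.scale /= mulr1 /flat.
  case: ifPn => h0; last by rewrite mulr0 normr0 mulr_ge0.
  have := HC h^-1; rewrite invr_gt0 h0 invrK => /(_ isT).
  by rewrite (gtr0_norm h0) hornerMX mulrA [h^-1 * _]mulrC.
apply/cvgr0Pnorm_le => e e0; near=> h.
have hC : `|h| <= e / (C + 1).
  by near: h; apply: dnbhs0_le; rewrite divr_gt0// ltr_wpDl.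
apply: le_trans (bound h) _.
apply: (@le_trans _ _ ((C + 1) * (e / (C + 1)))).
  by apply: ler_pM => //; rewrite lerDl.
by rewrite mulrC divfK// gt_eqF// ltr_wpDl.
Unshelve. all: by end_near.
Qed.

Lemma elementary_derive f : elementary f ->
  exists2 f', elementary f' & forall x : R, is_derive x 1 f (f' x).
Proof.
elim=> {f}.
- by move=> c; exists (fun=> 0); [exact: elementary_cst|move=> x; exact: is_derive_cst].
- move=> P; exists (flat (flat_deriv P)); first exact: elementary_flat.
  by move=> x; exact: is_derive_flat.
- move=> s c f fe [f' f'e df]; exists (fun x => f' (s * x + c) * s).
    apply: elementary_mul; [exact: elementary_affine|exact: elementary_cst].
  move=> x; apply: (@is_derive1_comp _ f (fun x => s * x + c)).
  by apply: is_derive_eq; rewrite /GRing.scale /= ?(mulr1, mulr0, addr0).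
- move=> f g fe [f' f'e df] ge [g' g'e dg]; exists (fun x => f' x + g' x).
    exact: elementary_add.
  by move=> x; apply: is_derive_eq.
- move=> f g fe [f' f'e df] ge [g' g'e dg].
  exists (fun x => f x * g' x + g x * f' x).
    by apply: elementary_add; exact: elementary_mul.
  by move=> x; apply: is_derive_eq.
- move=> f fN0 fe [f' f'e df]; exists (fun x => -1 * ((f x)^-1 * (f x)^-1 * f' x)).
    apply: elementary_mul; first exact: elementary_cst.
    by repeat apply: elementary_mul => //; exact: elementary_inv.
  move=> x; rewrite (_ : -1 * _ = - (f x) ^- 2 *: f' x); first exact: is_deriveV.
  by rewrite /GRing.scale /= mulN1r mulNr expr2 invfM.
Qed.

Lemma elementary_continuous f : elementary f -> continuous f.
Proof.
move=> /elementary_derive[f' _ df] x.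
by apply: differentiable_continuous; apply/derivable1_diffP; have [] := df x.
Qed.

Definition smoothstep (x : R) : R := flat 1 x / (flat 1 x + flat 1 (1 - x)).

Lemma flat1_ge0 x : 0 <= flat 1 x.
Proof. by rewrite /flat; case: ifP => // _; rewrite hornerE mul1r expR_ge0. Qed.

Lemma flat1_gt0 x : 0 < x -> 0 < flat 1 x.
Proof. by move=> x0; rewrite /flat x0 hornerE mul1r expR_gt0. Qed.

Lemma smoothstep_den_gt0 x : 0 < flat 1 x + flat 1 (1 - x).
Proof.
have [x0|x0] := ltP 0 x; first by rewrite ltr_pwDl ?flat1_gt0 ?flat1_ge0.
by rewrite ltr_wpDl ?flat1_ge0// flat1_gt0//; lra.
Qed.

Lemma elementary_smoothstep : elementary smoothstep.
Proof.
apply: elementary_mul; first exact: elementary_flat.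
apply: elementary_inv; first by move=> x; rewrite gt_eqF// smoothstep_den_gt0.
apply: elementary_add; first exact: elementary_flat.
rewrite (_ : (fun x => _) = (fun x => flat 1 (-1 * x + 1))); last first.
  by apply/funext => x; congr flat; ring.
by apply: elementary_affine; exact: elementary_flat.
Qed.

Lemma smoothstep_itv x : 0 <= smoothstep x <= 1.
Proof.
have d0 := smoothstep_den_gt0 x; apply/andP; split.
  by rewrite /smoothstep divr_ge0 ?flat1_ge0// ltW.
by rewrite /smoothstep ler_pdivrMr// mul1r lerDl flat1_ge0.
Qed.

Lemma smoothstep_le0 x : x <= 0 -> smoothstep x = 0.
Proof. by move=> x0; rewrite /smoothstep {1}/flat ltNge x0 mul0r. Qed.

Lemma smoothstep_ge1 x : 1 <= x -> smoothstep x = 1.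
Proof.
move=> x1; rewrite /smoothstep {3}/flat ltNge subr_le0 x1 addr0 divff//.
by rewrite gt_eqF// flat1_gt0//; lra.
Qed.

Definition mollifier : R -> R := derive1 smoothstep.

Lemma mollifier_deriv : elementary mollifier /\
  forall x : R, is_derive x (1 : R) smoothstep (mollifier x).
Proof.
have [rho rhoe drho] := elementary_derive elementary_smoothstep.
suff -> : mollifier = rho by [].
by apply/funext => x; rewrite /mollifier derive1E; have [_ <-] := drho x.
Qed.

Lemma elementary_mollifier : elementary mollifier.
Proof. by have [] := mollifier_deriv. Qed.

Lemma is_derive_smoothstep x : is_derive x (1 : R) smoothstep (mollifier x).
Proof. by have [_] := mollifier_deriv. Qed.

(** Outside [0, 1] the step is locally constant. *)
Lemma mollifier_out x : x < 0 \/ 1 < x -> mollifier x = 0.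
Proof.
move=> x01; have [_ <-] := is_derive_smoothstep x.
case: x01 => x01.
  have [_ <-] : is_derive x (1 : R) smoothstep 0; last by [].
  apply: (@is_derive_near_cst _ 0).
  by near=> y; rewrite smoothstep_le0//; apply: ltW; near: y; exact: lt_nbhsl.
have [_ <-] : is_derive x (1 : R) smoothstep 0; last by [].
apply: (@is_derive_near_cst _ 1).
by near=> y; rewrite smoothstep_ge1//; apply: ltW; near: y; exact: lt_nbhsr.
Unshelve. all: by end_near.
Qed.

Lemma mollifier_bounded : exists2 M : R, 0 < M & forall x, `|mollifier x| <= M.
Proof.
have [||c _ Hc] := @EVT_max R (fun x => `|mollifier x|) 0 1 => //.
  apply: continuous_subspaceT => x; apply: continuous_comp.
    exact/elementary_continuous/elementary_mollifier.
  exact: norm_continuous.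
exists (`|mollifier c| + 1) => [//|x].
have [x0|x0] := ltP x 0; first by rewrite mollifier_out ?normr0//; left.
have [x1|x1] := ltP 1 x; first by rewrite mollifier_out ?normr0//; right.
by rewrite (le_trans (Hc x _)) ?in_itv/= ?x0// lerDl.
Qed.

(** The step rises from 0 to 1 on [c, c + h], and the pulse is its derivative,
    so that the integral of the pulse is 1 by the fundamental theorem of
    calculus, whatever the sign and the shape of the mollifier. *)
Definition step (h c x : R) : R := smoothstep (h^-1 * (x - c)).
Definition pulse (h c x : R) : R := h^-1 * mollifier (h^-1 * (x - c)).

Lemma elementary_rescale f h c : elementary f ->
  elementary (fun x => f (h^-1 * (x - c))).
Proof.
move=> fe; rewrite (_ : (fun x => _) = (fun x => f (h^-1 * x + - (h^-1 * c)))).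
  exact: elementary_affine.
by apply/funext => x; rewrite mulrBr.
Qed.

Lemma elementary_step h c : elementary (step h c).
Proof. exact/elementary_rescale/elementary_smoothstep. Qed.

Lemma elementary_pulse h c : elementary (pulse h c).
Proof.
apply: elementary_mul; first exact: elementary_cst.
exact/elementary_rescale/elementary_mollifier.
Qed.

Lemma is_derive_step h c x : is_derive x (1 : R) (step h c) (pulse h c x).
Proof.
rewrite /pulse mulrC.
apply: (@is_derive1_comp _ smoothstep (fun x => h^-1 * (x - c))).
  exact: is_derive_smoothstep.
by apply: is_derive_eq; rewrite /GRing.scale /= ?(mulr1, mulr0, addr0, subr0).
Qed.

Lemma step_itv h c x : 0 <= step h c x <= 1.
Proof. exact: smoothstep_itv. Qed.

Lemma step_le h c x : 0 < h -> x <= c -> step h c x = 0.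
Proof.
by move=> h0 xc; apply: smoothstep_le0; rewrite pmulr_rle0 ?invr_gt0// subr_le0.
Qed.

Lemma step_ge h c x : 0 < h -> c + h <= x -> step h c x = 1.
Proof.
move=> h0 xc; apply: smoothstep_ge1.
by rewrite mulrC ler_pdivlMr// mul1r lerBrDl.
Qed.

Lemma pulse_out h c x : 0 < h -> x \notin `[c, c + h] -> pulse h c x = 0.
Proof.
move=> h0; rewrite in_itv/= negb_and -!ltNge => H.
rewrite /pulse mollifier_out ?mulr0//.
case/orP: H => H; [left|right].
  by rewrite pmulr_rlt0 ?invr_gt0// subr_lt0.
by rewrite mulrC ltr_pdivlMr// mul1r ltrBrDl.
Qed.

Lemma integral_pulse h c : 0 < h ->
  (\int[lebesgue_measure]_(x in `[c, (c + h)%R]) (pulse h c x)%:E = 1)%E.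
Proof.
move=> h0; rewrite (@continuous_FTC2 _ _ (step h c)).
- by rewrite step_ge// step_le// sube0.
- by rewrite ltrDl.
- exact/continuous_subspaceT/elementary_continuous/elementary_pulse.
- have sc := elementary_continuous (elementary_step h c).
  split.
  + by move=> x _; have [] := is_derive_step h c x.
  + exact/cvg_at_right_filter/sc.
  + exact/cvg_at_left_filter/sc.
- by move=> x _; rewrite derive1E; have [_ ->] := is_derive_step h c x.
Qed.

End OneDim.

(** * Product test functions and measurability in the plane *)

Section TwoDim.
Context {R : realType}.
Implicit Types (f g : R -> R) (x : R * R).
Local Notation plane := (measurableTypeR R * measurableTypeR R)%type.
Local Notation mu2 := (@lebesgue_measure R \x @lebesgue_measure R)%E.

Definition tensor f g x : R := f x.1 * g x.2.

Lemma is_derive_tensor1 f g x (d : R) : is_derive x.1 (1 : R) f d ->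
  is_derive x e1 (tensor f g) (d * g x.2).
Proof.
move=> [df Ef].
have H : h^-1 *: ((tensor f g \o shift x) (h *: e1) - tensor f g x) @[h --> 0^']
    --> d * g x.2.
  rewrite (_ : (fun h => _) =
     (fun h => h^-1 *: ((f \o shift x.1) (h *: (1:R)) - f x.1) * g x.2)).
    apply: cvgM; last exact: cvg_cst.
    by rewrite -Ef; exact: df.
  apply/funext => h; rewrite /tensor /GRing.scale /= /GRing.scale /=.
  by rewrite mulr0 add0r -mulrBl mulrA.
by apply: DeriveDef; [apply/cvg_ex; exists (d * g x.2)|exact/cvg_lim].
Qed.

Lemma is_derive_tensor2 f g x (d : R) : is_derive x.2 (1 : R) g d ->
  is_derive x e2 (tensor f g) (f x.1 * d).
Proof.
move=> [dg Eg].
have H : h^-1 *: ((tensor f g \o shift x) (h *: e2) - tensor f g x) @[h --> 0^']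
    --> f x.1 * d.
  rewrite (_ : (fun h => _) =
     (fun h => f x.1 * (h^-1 *: ((g \o shift x.2) (h *: (1:R)) - g x.2)))).
    apply: cvgM; first exact: cvg_cst.
    by rewrite -Eg; exact: dg.
  apply/funext => h; rewrite /tensor /GRing.scale /= /GRing.scale /=.
  by rewrite mulr0 add0r -mulrBr mulrCA.
by apply: DeriveDef; [apply/cvg_ex; exists (f x.1 * d)|exact/cvg_lim].
Qed.

Lemma tensor_continuous f g : continuous f -> continuous g ->
  continuous (tensor f g).
Proof.
move=> cf cg x; apply: cvgM.
  by apply: continuous_comp; [exact: cvg_fst|exact: cf].
by apply: continuous_comp; [exact: cvg_snd|exact: cg].
Qed.

(** A partial derivative of a product of elementary functions of one variable
    each is again such a product; hence induction on the list of derivations. *)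
Lemma smooth_tensor f g : elementary f -> elementary g -> smooth (tensor f g).
Proof.
move=> fe ge s /=.
suff [f' [g' [fe' ge' ->]]] : exists f' g', [/\ elementary f', elementary g' &
    foldr partial (tensor f g) s = tensor f' g'].
  split; first by apply: tensor_continuous; exact: elementary_continuous.
  have [f'' _ df] := elementary_derive fe'.
  have [g'' _ dg] := elementary_derive ge'.
  move=> x; split.
    by have [] := is_derive_tensor1 g' (df x.1).
  by have [] := is_derive_tensor2 f' (dg x.2).
elim: s => [|[] s [f' [g' [fe' ge' /= ->]]]]; first by exists f, g.
- have [g'' ge'' dg] := elementary_derive ge'.
  exists f', g''; split => //; apply/funext => x.
  by have [_] := is_derive_tensor2 f' (dg x.2).
- have [f'' fe'' df] := elementary_derive fe'.
  exists f'', g'; split => //; apply/funext => x.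
  by have [_] := is_derive_tensor1 g' (df x.1).
Qed.

Definition rect (p q r s : R) : set (R * R) := `[p, q] `*` `[r, s].

Lemma rect_compact (p q r s : R) : compact (rect p q r s).
Proof. by apply: compact_setX; exact: segment_compact. Qed.

Lemma rect_half_plane (p q r s : R) : 0 < r -> rect p q r s `<=` half_plane.
Proof.
move=> r0 x [_]; rewrite /= in_itv/= => /andP[rx _].
exact: lt_le_trans rx.
Qed.

Lemma tensor_out f g (p q r s : R) :
  (forall t, t \notin `[p, q] -> f t = 0) ->
  (forall t, t \notin `[r, s] -> g t = 0) ->
  forall x, ~ rect p q r s x -> tensor f g x = 0.
Proof.
move=> f0 g0 x; rewrite /tensor /rect /= => xS.
have [x1|x1] := boolP (x.1 \in `[p, q]); last by rewrite f0 ?mul0r.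
have [x2|x2] := boolP (x.2 \in `[r, s]); last by rewrite g0 ?mulr0.
by case: xS.
Qed.

Lemma Cc_infty_tensor f g (p q r s : R) : 0 < r -> elementary f -> elementary g ->
  (forall t, t \notin `[p, q] -> f t = 0) ->
  (forall t, t \notin `[r, s] -> g t = 0) -> Cc_infty (tensor f g).
Proof.
move=> r0 fe ge f0 g0; split; first exact: smooth_tensor.
exists (rect p q r s); split; [exact: rect_compact|exact: rect_half_plane|].
exact: tensor_out.
Qed.

Lemma measurable_rect (p q r s : R) : measurable (rect p q r s : set plane).
Proof. by apply: measurableX; exact: measurable_itv. Qed.

Lemma mu2_rect p q r s : p <= q -> r <= s ->
  mu2 (rect p q r s) = ((q - p) * (s - r))%:E.
Proof.
move=> pq rs; rewrite product_measure1E//= !lebesgue_measure_itv/= !lte_fin.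
have E (u v : R) : u <= v -> (if (u < v)%R then v%:E - u%:E else 0)%E = (v - u)%:E.
  by rewrite le_eqVlt => /orP[/eqP->|->//]; rewrite ltxx subrr.
by rewrite !E.
Qed.

(** The product sigma-algebra contains the open sets because the boxes with
    rational centre and inverse integer radius form a countable base. *)
Lemma open_measurable_plane (U : set (R * R)) : open U -> measurable (U : set plane).
Proof.
move=> oU.
pose I (q : rat) (n : nat) : set R :=
  [set` `](ratr q - n.+1%:R^-1), (ratr q + n.+1%:R^-1)[].
pose B (q : rat * rat * nat) : set plane := I q.1.1 q.2 `*` I q.1.2 q.2.
have mB q : measurable (B q) by apply: measurableX; exact: measurable_itv.
rewrite (_ : U = \bigcup_q (if `[< B q `<=` U >] then B q else set0)).
  apply: countable_bigcupT_measurable; first exact: countableP.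
  by move=> q; case: ifP.
apply/seteqP; split => [x Ux|x [q _]]; last by case: asboolP => // qU; exact: qU.
have /nbhs_ballP[e /= e0 eU] : nbhs x U by exact: open_nbhs_nbhs.
pose n := Num.truncn (2 / e); pose d : R := n.+1%:R^-1.
have d0 : 0 < d by rewrite invr_gt0.
have de : d + d < e.
  have : 2 / e < n.+1%:R by exact: truncnS_gt.
  rewrite ltr_pdivrMr// mulrC -ltr_pdivrMr// => ?.
  by rewrite -mulr2n -mulr_natl.
have approx (t : R) : exists q : rat, I q n t.
  have /rat_in_itvoo[q] : t - d < t + d by rewrite ltrD2l gtrN.
  rewrite in_itv/= => /andP[q1 q2]; exists q; rewrite /I /= in_itv/= -/d.
  by apply/andP; split; lra.
have [q1 hq1] := approx x.1; have [q2 hq2] := approx x.2.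
exists (q1, q2, n) => //; rewrite asboolT; first by split.
have near2 (q : rat) (u t : R) : I q n u -> I q n t -> `|u - t| < e.
  rewrite /I /= !in_itv/= -/d ltr_distl => /andP[? ?] /andP[? ?].
  by apply/andP; split; lra.
by move=> y [y1 y2]; apply: eU; split; [exact: near2 y1|exact: near2 y2].
Qed.

Lemma continuous_measurable_plane (f : R * R -> R) : continuous f ->
  measurable_fun (setT : set plane) f.
Proof.
move=> /continuousP cf; apply: (measurability _ (RGenOpens.measurableE R)).
move=> _ [_ [a [b ->] <-]]; rewrite setTI; apply: open_measurable_plane.
exact/cf/interval_open.
Qed.

End TwoDim.

(** * Weighted Cauchy-Schwarz and approximate Dirac masses *)

Section Integrals.
Context {R : realType}.
Implicit Types (f g : R -> R) (x : R * R).
Local Notation plane := (measurableTypeR R * measurableTypeR R)%type.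
Local Notation mu := (@lebesgue_measure R).
Local Notation mu2 := (@lebesgue_measure R \x @lebesgue_measure R)%E.

Lemma Rintegral_support (D S : set (R * R)) (w : R * R -> R) : S `<=` D ->
  (forall x, ~ S x -> w x = 0) ->
  \int[mu2]_(x in D) w x = \int[mu2]_(x in S) w x.
Proof.
move=> SD w0; rewrite [LHS]Rintegral_mkcond [RHS]Rintegral_mkcond.
congr Rintegral; apply/funext => x; rewrite !patchE.
case: ifPn => xD; case: ifPn => xS //.
  by rewrite w0//; move/negP: xS; rewrite inE.
by move: xS xD; rewrite !inE => /SD xD /negP; rewrite inE.
Qed.

(** The right-hand side of the hypothesis is least at [l = sqrt (B / A)]; using
    [l = X / A] instead gives the same conclusion without square roots. *)
Lemma discriminant_bound (X A B : R) : 0 <= X -> 0 <= A -> 0 <= B ->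
  (forall l, 0 < l -> X *+ 2 <= l * A + l^-1 * B) -> X ^+ 2 <= B * A.
Proof.
move=> X0 A0 B0 H; have [->|XN0] := eqVneq X 0; first by rewrite expr0n mulr_ge0.
have {}X0 : 0 < X by rewrite lt_neqAle eq_sym XN0.
have [A00|AN0] := eqVneq A 0.
  (* For A = 0, large l makes the bound on X contradictory. *)
  have B1 : 0 < (B + 1) / X by rewrite divr_gt0// ltr_wpDl.
  have := H _ B1; rewrite A00 mulr0 add0r invf_div => {}H.
  have : X / (B + 1) * B <= X.
    by rewrite mulrAC ler_pdivrMr ?ltr_wpDl// ler_pM2l// lerDl.
  by move=> H1; lra.
have {}A0 : 0 < A by rewrite lt_neqAle eq_sym AN0.
have XA : 0 < X / A by rewrite divr_gt0.
have := H _ XA; rewrite divfK ?gt_eqF// invf_div mulr2n lerD2l.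
by rewrite mulrAC ler_pdivlMr// -expr2 mulrC.
Qed.

Lemma rect_fin (p q r s : R) : (mu2 (rect p q r s) < +oo)%E.
Proof.
rewrite product_measure1E//= !lebesgue_measure_itv/= !lte_fin.
have E (u v : R) : ((if (u < v)%R then v%:E - u%:E else 0) \is a fin_num)%E.
  by case: ifP.
have E0 (u v : R) : (0 <= if (u < v)%R then v%:E - u%:E else 0)%E.
  by case: ifP => // uv; rewrite lee_fin subr_ge0 ltW.
by rewrite -ge0_fin_numE ?fin_numM// mule_ge0.
Qed.

(** Compactness of the rectangle gives boundedness, and its finite measure does
    the rest. *)
Lemma continuous_integrable_rect p q r s (w : R * R -> R) : continuous w ->
  mu2.-integrable (rect p q r s : set plane) (EFin \o w).
Proof.
move=> cw; apply: measurable_bounded_integrable.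
- exact: measurable_rect.
- exact: rect_fin.
- by apply: measurable_funTS; exact: continuous_measurable_plane.
- have /compact_bounded := continuous_compact (continuous_subspaceT cw)
    (@rect_compact _ p q r s).
  move=> [M [Mr HM]]; exists M; split => // N MN x xS.
  by apply: (HM N MN); exists x.
Qed.

Lemma measurable_inv : measurable_fun [set: R] (fun t : R => t^-1).
Proof.
rewrite -(setvU [set (0:R)]); apply/measurable_funU; [exact: measurableC|by []|split].
  apply: open_continuous_measurable_fun.
    by apply: closed_openC; exact: closed_eq.
  move=> x; rewrite inE => /eqP x0; exact: inv_continuous.
exact: measurable_fun_set1.
Qed.

Lemma measurable_pow_inv2 n : measurable_fun (setT : set plane) (fun x : R * R => x.2 ^- n).
Proof.
apply: (@measurableT_comp _ _ _ _ _ _ (fun t : R => t^-1)); first exact: measurable_inv.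
apply: (@measurableT_comp _ _ _ _ _ _ (fun t : R => t ^+ n)).
  exact: exprn_measurable.
exact: measurable_snd.
Qed.

(** On the rectangle [x_2 <= s], so that [|u * eta|] is at most the product of
    [|u| / x_2] and [c * s].  Integrating the Young inequality with a free
    parameter [l] and then optimising over [l] yields Cauchy-Schwarz for this
    product, the second factor being a constant on a set of known area. *)
Lemma weighted_CauchySchwarz (u eta w : R * R -> R) (p q r s c A : R) :
  p <= q -> 0 < r -> r <= s ->
  mu2.-integrable (rect p q r s : set plane) (EFin \o u) ->
  measurable_fun (rect p q r s : set plane) eta ->
  (forall x, `|eta x| <= c) -> (forall x, ~ rect p q r s x -> eta x = 0) ->
  measurable_fun (rect p q r s : set plane) w ->
  (forall x, rect p q r s x -> u x ^+ 2 * x.2 ^- 2 <= w x) ->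
  (\int[mu2]_(x in rect p q r s) (w x)%:E <= A%:E)%E ->
  (\int[mu2]_(x in half_plane) (u x * eta x)) ^+ 2
    <= c ^+ 2 * s ^+ 2 * ((q - p) * (s - r)) * A.
Proof.
move=> pq r0 rs iu meta etac eta0 mw uw wA.
set S := rect p q r s in iu meta eta0 mw uw wA *.
have mS : measurable (S : set plane) by exact: measurable_rect.
have mu_ : measurable_fun (S : set plane) u.
  by apply/measurable_EFinP; exact: measurable_int iu.
have c0 : 0 <= c by apply: le_trans (etac (0, 0)).
have w0 x : S x -> 0 <= w x.
  by move=> /uw; apply: le_trans; rewrite mulr_ge0 ?sqr_ge0// invr_ge0 sqr_ge0.
have A0 : 0 <= A.
  rewrite -lee_fin; apply: le_trans wA; apply: integral_ge0 => x xS.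
  by rewrite lee_fin w0.
have s0 : 0 <= s by rewrite (le_trans (ltW r0)).
have iue : mu2.-integrable (S : set plane) (EFin \o (fun x => u x * eta x)).
  apply: (le_integrable mS _ _ (integrableZl mS c iu)).
    by apply/measurable_EFinP; exact: measurable_funM.
  move=> x xS /=; rewrite lee_fin !normrM mulrC ler_wpM2r//.
  by rewrite (le_trans (etac x))// ler_norm.
rewrite (@Rintegral_support _ S)//; [|exact: rect_half_plane|]; last first.
  by move=> x /eta0 ->; rewrite mulr0.
rewrite -real_normK ?num_real//; apply: discriminant_bound => //.
  by rewrite mulr_ge0// mulr_ge0// ?sqr_ge0// subr_ge0.
move=> l l0.
have pointwise x : S x ->
    `|u x * eta x| <= l / 2 * w x + (2 * l)^-1 * (c * s) ^+ 2.
  move=> xS; have [x1 x2] := xS; move: x2; rewrite /= in_itv/= => /andP[rx xs].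
  have y0 : 0 < x.2 by exact: lt_le_trans rx.
  set k := `|u x| / x.2.
  have k0 : 0 <= k by rewrite divr_ge0// ltW.
  have kw : k ^+ 2 <= w x.
    by apply: le_trans (uw x xS); rewrite /k expr_div_n real_normK ?num_real.
  have uk : `|u x * eta x| <= k * (c * s).
    rewrite normrM (_ : `|u x| = k * x.2); last by rewrite /k divfK ?gt_eqF.
    by rewrite -mulrA ler_wpM2l// mulrC ler_pM// ltW.
  apply: le_trans uk _.
  apply: (@le_trans _ _ (l / 2 * k ^+ 2 + (2 * l)^-1 * (c * s) ^+ 2)).
    rewrite -subr_ge0 (_ : _ - _ = (2 * l)^-1 * (l * k - c * s) ^+ 2).
      by rewrite mulr_ge0 ?sqr_ge0// invr_ge0 mulr_ge0// ltW.
    by field; rewrite gt_eqF.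
  by rewrite lerD2r ler_wpM2l// divr_ge0// ltW.
set I := \int[mu2]_(x in S) _.
suff H : (`|I|%:E <= (l / 2 * A + (2 * l)^-1 * (c * s) ^+ 2 * ((q - p) * (s - r)))%:E)%E.
  move: H; rewrite lee_fin => H; rewrite mulr2n; apply: le_trans (lerD H H) _.
  rewrite le_eqVlt; apply/orP; left; apply/eqP; rewrite exprMn; field.
  by rewrite gt_eqF.
rewrite /I EFin_normr_Rintegral//.
apply: le_trans (le_abse_integral _ mS (measurable_int _ iue)) _.
apply: (@le_trans _ _ (\int[mu2]_(x in S) ((l / 2)%:E * (w x)%:E + ((2 * l)^-1 * (c * s) ^+ 2)%:E))%E).
  apply: ge0_le_integral => //=.
  - by do 2 apply: measurableT_comp => //; exact: measurable_funM.
  - apply: emeasurable_funD => //.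
    by apply: measurable_funeM; exact/measurable_EFinP.
rewrite ge0_integralD//=; last 3 first.
- by move=> x xS; rewrite mule_ge0// lee_fin ?w0// divr_ge0// ltW.
- by apply: measurable_funeM; exact/measurable_EFinP.
- by move=> x xS; rewrite lee_fin mulr_ge0 ?sqr_ge0// invr_ge0 mulr_ge0// ltW.
rewrite ge0_integralZl//=; last 2 first.
- exact/measurable_EFinP.
- by rewrite lee_fin divr_ge0// ltW.
rewrite [X in (_ + X)%E]integral_cst// (_ : _ S = ((q - p) * (s - r))%:E); last exact: mu2_rect.
rewrite EFinD leeD//.
by rewrite [leRHS]EFinM lee_wpmul2l// lee_fin divr_ge0// ltW.
Qed.

Lemma L1loc_rect (u : R * R -> R) (p q r s : R) : L1loc u -> 0 < r ->
  mu2.-integrable (rect p q r s : set plane) (EFin \o u).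
Proof. by move=> lu r0; apply: lu; [exact: rect_compact|exact: rect_half_plane]. Qed.

(** The open half plane is a countable union of compact rectangles. *)
Lemma L1loc_measurable (u : R * R -> R) : L1loc u ->
  measurable_fun (half_plane : set plane) u.
Proof.
move=> lu.
have -> : (half_plane : set plane) =
    \bigcup_n rect (- n%:R) n%:R n.+1%:R^-1 n%:R.
  apply/seteqP; split => [x x0|x [n _]]; last exact: rect_half_plane.
  pose n := Num.truncn (`|x.1| + `|x.2| + x.2^-1).
  have hn : `|x.1| + `|x.2| + x.2^-1 < n.+1%:R by exact: truncnS_gt.
  have x20 : 0 < x.2 by [].
  have xV0 : 0 < x.2^-1 by rewrite invr_gt0.
  have a1 := normr_ge0 x.1; have a2 := normr_ge0 x.2.
  exists n.+1 => //; split; rewrite /= in_itv/= ?(-ler_norml).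
    by rewrite -ler_norml; lra.
  apply/andP; split.
    rewrite -[leRHS]invrK lef_pV2 ?posrE// -natr1; lra.
  by have := ler_norm x.2; lra.
apply/measurable_fun_bigcup => n; first exact: measurable_rect.
by apply/measurable_EFinP; exact: measurable_int (L1loc_rect _ _ _ lu _).
Qed.

Lemma integral_tensor f g (p q r s : R) : continuous f -> continuous g ->
  (\int[mu2]_(x in rect p q r s) (tensor f g x)%:E =
  (\int[mu]_(t in `[p, q]) (f t)%:E) * (\int[mu]_(t in `[r, s]) (g t)%:E))%E.
Proof.
move=> cf cg.
have i2 := continuous_integrable_rect p q r s (tensor_continuous cf cg).
have intg (k : R -> R) (t u : R) : continuous k ->
    mu.-integrable `[t, u] (EFin \o k).
  move=> ck; apply: continuous_compact_integrable; first exact: segment_compact.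
  exact: continuous_subspaceT.
rewrite integral_mkcond -fubini1; last first.
  by apply/(integrable_mkcond _ (measurable_rect _ _ _ _)).
rewrite /fubini_F [X in _ = (X * _)%E]integral_mkcond.
have fin_g : (\int[mu]_(t in `[r, s]) (g t)%:E)%E \is a fin_num.
  exact: integrable_fin_num (intg _ _ _ cg).
rewrite -(fineK fin_g) -integralZr//; last first.
  have mpq : measurable (`[p, q]%classic : set (measurableTypeR R)).
    exact: measurable_itv.
  exact: ((integrable_mkcond _ mpq).1 (intg f p q cf)).
apply: eq_integral => t _; rewrite fineK// patchE.
case: ifPn => tpq.
  rewrite -integralZl//; last exact: intg.
  rewrite [RHS]integral_mkcond; apply: eq_integral => z _.
  rewrite !patchE.
  have -> : ((t, z) \in rect p q r s) = (z \in [set` `[r, s]]).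
    apply/idP/idP => [/set_mem[_ zrs]|/set_mem zrs]; first exact: mem_set zrs.
    by apply: mem_set; split => //; exact: set_mem.
  by case: ifP.
rewrite mul0e integral0_eq// => z _.
have nS : ~ rect p q r s (t, z).
  by case=> tin _; apply: (negP tpq); exact: mem_set tin.
by rewrite patchE memNset.
Qed.

(** The shift by [h] in the vertical direction keeps the support inside the open
    half plane when [p] lies on the axis, where test functions must vanish. *)
Definition delta (h : R) (p : R * R) : R * R -> R :=
  tensor (pulse h p.1) (pulse h (p.2 + h)).

Lemma delta_continuous (h : R) (p : R * R) : continuous (delta h p).
Proof.
by apply: tensor_continuous; exact/elementary_continuous/elementary_pulse.
Qed.

(** The kernel has integral 1, is at most [(M / h) ^ 2] in absolute value, and
    lives on a square of side [h] close to [p]; so the error is at most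
    [M ^ 2] times the oscillation of [f] near [p].  Positivity of the kernel is
    replaced by this bound. *)
Lemma delta_cvg (f : R * R -> R) (p : R * R) : continuous f -> 0 <= p.2 ->
  \int[mu2]_(x in half_plane) (f x * delta h p x) @[h --> 0^'+] --> f p.
Proof.
move=> cf p2; have [M M0 HM] := @mollifier_bounded R.
apply/cvgrPdist_le => e e0.
have e'0 : 0 < e / M ^+ 2 by rewrite divr_gt0// exprn_gt0.
have /cvgrPdist_le/(_ _ e'0)/nbhs_ballP[d /= d0 dP] := cf p.
near=> h.
have h0 : 0 < h by near: h; exact: nbhs_right_gt.
have hd : h * 2 < d.
  by rewrite -ltr_pdivlMr//; near: h; apply: nbhs_right_lt; rewrite divr_gt0.
pose S := rect p.1 (p.1 + h) (p.2 + h) (p.2 + h + h).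
have SH : S `<=` half_plane by apply: rect_half_plane; rewrite ltr_wpDl.
have mS : measurable (S : set plane) by exact: measurable_rect.
have muS : mu2 S = (h * h)%:E.
  rewrite mu2_rect ?lerDl ?ltW//; congr (_ * _)%:E; ring.
have dS x : ~ S x -> delta h p x = 0.
  by apply: tensor_out => t; exact: pulse_out.
have intS (w : R * R -> R) : continuous w ->
    mu2.-integrable (S : set plane) (EFin \o w).
  exact: continuous_integrable_rect.
have cd := @delta_continuous h p.
have cfd : continuous (fun x => f x * delta h p x).
  by move=> x; apply: cvgM; [exact: cf|exact: cd].
have cfpd : continuous (fun x => f p * delta h p x).
  by move=> x; apply: cvgM; [exact: cvg_cst|exact: cd].
have cdiff : continuous (fun x => f p * delta h p x - f x * delta h p x).
  by move=> x; apply: cvgB; [exact: cfpd|exact: cfd].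
rewrite (Rintegral_support SH); last by move=> x /dS ->; rewrite mulr0.
have -> : f p = \int[mu2]_(x in S) (f p * delta h p x).
  rewrite RintegralZl//; last exact: intS.
  rewrite /Rintegral integral_tensor.
  - by rewrite !integral_pulse// mul1e/= mulr1.
  - exact/elementary_continuous/elementary_pulse.
  - exact/elementary_continuous/elementary_pulse.
rewrite -RintegralB//; [|exact: intS|exact: intS].
rewrite -lee_fin EFin_normr_Rintegral//; last exact: intS.
apply: le_trans (le_abse_integral _ mS (measurable_int _ (intS _ cdiff))) _.
apply: (@le_trans _ _ (\int[mu2]_(x in S) (e / M ^+ 2 * (M / h) ^+ 2)%:E)%E).
  apply: ge0_le_integral => //=.
  - do 2 apply: measurableT_comp => //.
    by apply/measurable_EFinP; exact: (measurable_int _ (intS _ cdiff)).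
  - move=> x xS; rewrite lee_fin -mulrBl normrM ler_pM//.
      apply: dP; move: xS => [/=]; rewrite !in_itv/= => /andP[? ?] /andP[? ?].
      by split; rewrite /ball/= ltr_distl; apply/andP; split; lra.
    have pM c t : `|pulse h c t| <= M / h.
      by rewrite normrM gtr0_norm ?invr_gt0// mulrC ler_wpM2r// invr_ge0 ltW.
    by rewrite normrM expr2 ler_pM.
rewrite integral_cst// (_ : _ S = (h * h)%:E); last exact: muS.
rewrite -EFinM lee_fin.
by rewrite le_eqVlt; apply/orP; left; apply/eqP; field; rewrite !gt_eqF.
Unshelve. all: by end_near.
Qed.

End Integrals.

(** * Stream functions on a box *)

Section Stream.
Context {R : realType}.
Implicit Types (f g : R -> R) (x : R * R).
Local Notation plane := (measurableTypeR R * measurableTypeR R)%type.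
Local Notation mu := (@lebesgue_measure R).
Local Notation mu2 := (@lebesgue_measure R \x @lebesgue_measure R)%E.

(** Prolonging [psi] constantly below the axis turns continuity on the closed
    half plane into continuity on the plane. *)
Definition extend_down (psi : R * R -> R) (x : R * R) : R :=
  psi (x.1, Num.max x.2 0).

Lemma extend_downE (psi : R * R -> R) x : 0 <= x.2 -> extend_down psi x = psi x.
Proof. by case: x => x1 x2 /= x0; rewrite /extend_down/= max_l. Qed.

Lemma extend_down_continuous (psi : R * R -> R) :
  {within closed_half_plane, continuous psi} -> continuous (extend_down psi).
Proof.
move=> /subspace_continuousP cpsi x.
pose pr (z : R * R) : R * R := (z.1, Num.max z.2 0).
have prH z : closed_half_plane (pr z) by rewrite /closed_half_plane/= le_max lexx orbT.
have cpr : pr z @[z --> x] --> pr x.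
  have c1 : z.1 @[z --> x] --> x.1 by exact: cvg_fst.
  have c2 : Num.max z.2 0 @[z --> x] --> Num.max x.2 0.
    apply: (@continuous_max R _ (fun z : R * R => z.2) (fun=> 0)).
      exact: cvg_snd.
    exact: cvg_cst.
  exact: cvg_pair c1 c2.
move=> A HA; have : nbhs x (pr @^-1` [set y | closed_half_plane y -> A (psi y)]).
  exact: cpr (cpsi _ (prH x) A HA).
by apply: filterS => z; apply; exact: prH.
Qed.

Lemma Rintegral_deltaB (f : R * R -> R) (h : R) (P Q : R * R) (p q r s : R) :
  continuous f -> 0 < r ->
  (forall x, ~ rect p q r s x -> delta h P x = 0) ->
  (forall x, ~ rect p q r s x -> delta h Q x = 0) ->
  \int[mu2]_(x in half_plane) (f x * (delta h P x - delta h Q x)) =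
  \int[mu2]_(x in half_plane) (f x * delta h P x) -
  \int[mu2]_(x in half_plane) (f x * delta h Q x).
Proof.
move=> cf r0 P0 Q0; have SH := @rect_half_plane _ p q r s r0.
rewrite !(Rintegral_support SH); last 3 first.
- by move=> x /Q0 ->; rewrite mulr0.
- by move=> x /P0 ->; rewrite mulr0.
- by move=> x xS; rewrite P0// Q0// subrr mulr0.
rewrite -RintegralB.
- by apply: eq_Rintegral => x _; rewrite mulrBr.
- exact: measurable_rect.
- apply: continuous_integrable_rect => x; apply: cvgM; first exact: cf.
  exact: delta_continuous.
- apply: continuous_integrable_rect => x; apply: cvgM; first exact: cf.
  exact: delta_continuous.
Qed.

Lemma eq_Rintegral_extend_down (psi eta : R * R -> R) :
  \int[mu2]_(x in half_plane) (psi x * eta x) =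
  \int[mu2]_(x in half_plane) (extend_down psi x * eta x).
Proof.
apply: eq_Rintegral => x; rewrite inE => /= x0.
by rewrite extend_downE// ltW.
Qed.

Lemma normr_pulse (M h c t : R) : 0 < h -> (forall t, `|mollifier t| <= M) ->
  `|pulse h c t| <= M / h.
Proof.
move=> h0 HM.
by rewrite normrM gtr0_norm ?invr_gt0// mulrC ler_wpM2r// invr_ge0 ltW.
Qed.

Lemma step_diff_le (h c d t : R) : `|step h c t - step h d t| <= 1.
Proof.
have /andP[? ?] := step_itv h c t; have /andP[? ?] := step_itv h d t.
by rewrite ler_norml; apply/andP; split; lra.
Qed.

Lemma step_diff_out (h c d lo hi t : R) : 0 < h ->
  lo <= c -> lo <= d -> c + h <= hi -> d + h <= hi ->
  t \notin `[lo, hi] -> step h c t - step h d t = 0.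
Proof.
move=> h0 lc ld ch dh; rewrite in_itv/= negb_and -!ltNge => /orP[tlo|thi].
  by rewrite !step_le ?subrr//; lra.
by rewrite !step_ge ?subrr//; lra.
Qed.

Lemma elementary_stepB (h c d : R) :
  elementary (fun t => step h c t - step h d t).
Proof.
rewrite (_ : (fun t => _) = (fun t => step h c t + -1 * step h d t)); last first.
  by apply/funext => t; rewrite mulN1r.
apply: elementary_add; first exact: elementary_step.
by apply: elementary_mul; [exact: elementary_cst|exact: elementary_step].
Qed.

Lemma is_derive_stepB (h c d t : R) :
  is_derive t (1 : R) (fun t => step h c t - step h d t)
    (pulse h c t - pulse h d t).
Proof.
have d1 := is_derive_step h c t; have d2 := is_derive_step h d t.
exact: is_deriveB.
Qed.

Lemma cvg_sqr (F : set_system R) (FF : Filter F) (u : R -> R) (l : R) :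
  u t @[t --> F] --> l -> u t ^+ 2 @[t --> F] --> l ^+ 2.
Proof. by move=> ul; rewrite expr2; under eq_fun do rewrite expr2; exact: cvgM. Qed.

Lemma at_right_sub_dnbhs (x : R) : x^'+ `=>` x^'.
Proof.
move=> A HA; have H : \forall y \near x, y != x -> A y by exact: HA.
suff : \forall y \near x, x < y -> A y by [].
by apply: filterS H => y Hy xy; apply: Hy; rewrite gt_eqF.
Qed.

Section Box.
(* The function w stands for |v|^2 / x_2^2 on the box and 0 elsewhere.  Keeping
   it abstract separates the estimates from the question of its measurability. *)
Context (a b : R) (v : R * R -> R * R) (psi w : R * R -> R).
Context (a0 : 0 < a) (b0 : 0 < b).
Context (psi_stream : stream_function v psi).
Context (v1_loc : L1loc (fst \o v)) (v2_loc : L1loc (snd \o v)).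
Context (mw : measurable_fun (setT : set plane) w) (w0 : forall x, 0 <= w x).
Context (w_ge : forall x, rect (- a) a 0 b x -> 0 < x.2 ->
  (v x).1 ^+ 2 * x.2 ^- 2 <= w x /\ (v x).2 ^+ 2 * x.2 ^- 2 <= w x).
Context (A : R) (w_int : (\int[mu2]_x (w x)%:E <= A%:E)%E).

Let cpsi : continuous (extend_down psi).
Proof. by have [cpsi _ _] := psi_stream; exact: extend_down_continuous. Qed.

Lemma subrect_box (p q r s : R) x : - a <= p -> q <= a -> 0 < r -> s <= b ->
  rect p q r s x -> rect (- a) a 0 b x /\ 0 < x.2.
Proof.
move=> ap qa r0 sb [/=]; rewrite !in_itv/= => /andP[? ?] /andP[? ?].
by split; [split; rewrite /= in_itv/=; apply/andP; split|]; lra.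
Qed.

(** The test function is a plateau of height 1 between 0 and [t] in the first
    variable, and a pulse of height at most [M / h] at distance [h] to [2 * h]
    from the axis in the second.  In the Cauchy-Schwarz bound,
    [(M / h) ^ 2] meets [(2 * h) ^ 2] and the area [2 * a * h]. *)
Lemma horizontal_estimate (M t h : R) : (forall t, `|mollifier t| <= M) ->
  0 < h -> - a <= t -> t + h <= a -> h <= a -> h + h <= b ->
  (\int[mu2]_(x in half_plane) (extend_down psi x * delta h (0, 0) x) -
   \int[mu2]_(x in half_plane) (extend_down psi x * delta h (t, 0) x)) ^+ 2
  <= 8 * M ^+ 2 * a * A * h.
Proof.
move=> HM h0 at_ tha ha hb.
have r0 : 0 < 0 + h by rewrite add0r.
have M0 : 0 <= M by apply: le_trans (HM 0).
pose al := fun s => step h 0 s - step h t s.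
pose be := pulse h (0 + h).
have al_out s : s \notin `[- a, a] -> al s = 0.
  by apply: step_diff_out => //; rewrite ?add0r// oppr_le0 ltW.
have be_out s : s \notin `[0 + h, 0 + h + h] -> be s = 0 by exact: pulse_out.
have eal : elementary al by exact: elementary_stepB.
have ebe : elementary be by exact: elementary_pulse.
have [_ /(_ _ (Cc_infty_tensor r0 eal ebe al_out be_out))[+ _] _] := psi_stream.
have dE x : 'D_e1 (tensor al be) x = delta h (0, 0) x - delta h (t, 0) x.
  have [_ ->] := is_derive_tensor1 be (is_derive_stepB h 0 t x.1).
  by rewrite mulrBl.
under eq_Rintegral => x _ do rewrite dE.
rewrite eq_Rintegral_extend_down (@Rintegral_deltaB _ _ _ _ (- a) a (0 + h) (0 + h + h))//; last 2 first.
- apply: tensor_out => s sI; apply: pulse_out => //=.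
  by apply: contra sI; rewrite !in_itv/= => /andP[? ?]; apply/andP; split; lra.
- apply: tensor_out => s sI; apply: pulse_out => //=.
  by apply: contra sI; rewrite !in_itv/= => /andP[? ?]; apply/andP; split; lra.
move=> ->; rewrite sqrrN.
apply: le_trans (@weighted_CauchySchwarz _ (snd \o v) (tensor al be) w (- a) a (0 + h) (0 + h + h) (M / h) A _ _ _ _ _ _ _ _ _ _) _ => //.
- lra.
- lra.
- exact: L1loc_rect.
- apply: measurable_funTS; apply: continuous_measurable_plane.
  by apply: tensor_continuous; exact: elementary_continuous.
- move=> x; rewrite /tensor normrM -[leRHS]mul1r ler_pM//.
    exact: step_diff_le.
  exact: normr_pulse.
- exact: tensor_out.
- exact: measurable_funTS.
- move=> x xS; have [||||xQ x0] := subrect_box _ _ _ _ xS => //; first by lra.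
  by have [] := w_ge xQ x0.
- apply: le_trans w_int; apply: ge0_subset_integral => //.
  + exact: measurable_rect.
  + exact/measurable_EFinP.
  + by move=> x _; rewrite lee_fin.
rewrite le_eqVlt; apply/orP; left; apply/eqP; field.
by rewrite gt_eqF.
Qed.

(** Here the pulse is in the first variable and the plateau, from the axis up to
    [y], in the second.  The factor [h] of the area cancels one of the two
    [h^-1] coming from the square of the pulse, and the other one turns [B] into
    a mean over [t, t + h]. *)
Lemma vertical_estimate (M t y h B : R) : (forall t, `|mollifier t| <= M) ->
  0 < h -> - a <= t -> t + h <= a -> 0 <= y -> y + h + h <= b ->
  (\int[mu2]_(x in `[t, (t + h)%R] `*` setT) (w x)%:E <= B%:E)%E ->
  (\int[mu2]_(x in half_plane) (extend_down psi x * delta h (t, 0) x) -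
   \int[mu2]_(x in half_plane) (extend_down psi x * delta h (t, y) x)) ^+ 2
  <= M ^+ 2 * (y + h + h) ^+ 2 * (y + h) * (B / h).
Proof.
move=> HM h0 at_ tha y0 yb HB.
have r0 : 0 < 0 + h by rewrite add0r.
have M0 : 0 <= M by apply: le_trans (HM 0).
pose al := pulse h t.
pose be := fun s => step h (0 + h) s - step h (y + h) s.
have al_out s : s \notin `[t, t + h] -> al s = 0 by exact: pulse_out.
have be_out s : s \notin `[0 + h, y + h + h] -> be s = 0.
  by apply: step_diff_out => //; lra.
have eal : elementary al by exact: elementary_pulse.
have ebe : elementary be by exact: elementary_stepB.
have [_ /(_ _ (Cc_infty_tensor r0 eal ebe al_out be_out))[_ +] _] := psi_stream.
have dE x : 'D_e2 (tensor al be) x = delta h (t, 0) x - delta h (t, y) x.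
  have [_ ->] := is_derive_tensor2 al (is_derive_stepB h (0 + h) (y + h) x.2).
  by rewrite mulrBr.
under eq_Rintegral => x _ do rewrite dE.
rewrite eq_Rintegral_extend_down (@Rintegral_deltaB _ _ _ _ t (t + h) (0 + h) (y + h + h))//; last 2 first.
- by apply: tensor_out => s sI; apply: pulse_out => //=;
    apply: contra sI; rewrite !in_itv/= => /andP[? ?]; apply/andP; split; lra.
- by apply: tensor_out => s sI; apply: pulse_out => //=;
    apply: contra sI; rewrite !in_itv/= => /andP[? ?]; apply/andP; split; lra.
move=> ->; rewrite sqrrN.
under eq_Rintegral => x _ do rewrite mulNr -mulrN.
apply: le_trans (@weighted_CauchySchwarz _ (fst \o v) (fun x => - tensor al be x) w t (t + h) (0 + h) (y + h + h) (M / h) B _ _ _ _ _ _ _ _ _ _) _ => //.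
- lra.
- lra.
- exact: L1loc_rect.
- apply: measurable_funTS; apply: continuous_measurable_plane => x.
  by apply: cvgN; apply: tensor_continuous; exact: elementary_continuous.
- move=> x; rewrite normrN /tensor normrM -[leRHS]mulr1 ler_pM//.
    exact: normr_pulse.
  exact: step_diff_le.
- by move=> x /(tensor_out al_out be_out) ->; rewrite oppr0.
- exact: measurable_funTS.
- move=> x xS; have [||||xQ x0] := subrect_box _ _ _ _ xS => //.
  by have [] := w_ge xQ x0.
- apply: le_trans HB; apply: ge0_subset_integral => //.
  + exact: measurable_rect.
  + by apply: measurableX => //; exact: measurable_itv.
  + by apply: measurable_funTS; exact/measurable_EFinP.
  + by move=> x _; rewrite lee_fin.
  + by move=> x [].
rewrite le_eqVlt; apply/orP; left; apply/eqP; field.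
by rewrite gt_eqF.
Qed.

(** Averages of [psi] near [(0, 0)] and near [(t, 0)] differ by [O (h ^ (1/2))],
    and [psi] is continuous up to the axis. *)
Lemma stream_axis0 (t : R) : - a <= t < a -> psi (t, 0) = 0.
Proof.
move=> /andP[at_ ta]; have [M M0 HM] := @mollifier_bounded R.
have [_ _ psi00] := psi_stream.
have c0 := @delta_cvg _ _ (0, 0) cpsi (lexx 0).
have ct := @delta_cvg _ _ (t, 0) cpsi (lexx 0).
pose I P h := \int[mu2]_(x in half_plane) (extend_down psi x * delta h P x).
have cL : (I (0%R, 0%R) h - I (t, 0%R) h) ^+ 2 @[h --> (0 : R)^'+] -->
    (extend_down psi (0, 0) - extend_down psi (t, 0)) ^+ 2.
  by apply: cvg_sqr; exact: cvgB.
have cR : 8 * M ^+ 2 * a * A * h @[h --> (0 : R)^'+] --> 8 * M ^+ 2 * a * A * 0.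
  by apply: cvgM; [exact: cvg_cst|exact: (@cvg_at_right_filter _ _ id 0 0 cvg_id)].
have sq0 : (extend_down psi (0, 0) - extend_down psi (t, 0)) ^+ 2 <= 8 * M ^+ 2 * a * A * 0.
  apply: (@ler_cvg_to R _ _ _ _ _ _ _ cL cR).
  near=> h; apply: (horizontal_estimate HM) => //.
  - have : h < a - t by near: h; apply: nbhs_right_lt; lra.
    lra.
  - by apply: ltW; near: h; exact: nbhs_right_lt.
  - have : h < b / 2 by near: h; apply: nbhs_right_lt; rewrite divr_gt0.
    lra.
move: sq0; rewrite mulr0 !extend_downE//= psi00 sub0r sqrrN => sq0.
by apply/eqP; rewrite -sqrf_eq0 eq_le sq0 sqr_ge0.
Unshelve. all: by end_near.
Qed.

Let marginal (t : R) : \bar R := (\int[mu]_y (w (t, y))%:E)%E.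

Lemma marginal_ge0 t : (0 <= marginal t)%E.
Proof. by apply: integral_ge0 => y _; rewrite lee_fin. Qed.

Lemma measurable_marginal : measurable_fun (setT : set (measurableTypeR R)) marginal.
Proof.
apply: (@measurable_fun_fubini_tonelli_F _ _ _ _ _ mu (fun x => (w x)%:E)).
  exact/measurable_EFinP.
by move=> x; rewrite lee_fin.
Qed.

Lemma integral_marginal (I : set (measurableTypeR R)) : measurable I ->
  (\int[mu2]_(x in I `*` setT) (w x)%:E = \int[mu]_(t in I) marginal t)%E.
Proof.
move=> mI; have mIT : measurable (I `*` setT : set plane) by exact: measurableX.
rewrite integral_mkcond fubini_tonelli1.
- rewrite [RHS]integral_mkcond; apply: eq_integral => t _.
  rewrite /fubini_F patchE; case: ifPn => tI.
    apply: eq_integral => y _; rewrite patchE mem_set//.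
    by split => //; exact: set_mem.
  apply: integral0_eq => y _; rewrite patchE memNset// => -[tI' _].
  by apply: (negP tI); exact: mem_set tI'.
- apply/(measurable_restrictT _ mIT); apply: measurable_funTS.
  exact/measurable_EFinP.
- by move=> x; apply: erestrict_ge0 => y _; rewrite lee_fin.
Qed.

Lemma integrable_marginal : mu.-integrable setT marginal.
Proof.
apply/integrableP; split; first exact: measurable_marginal.
under eq_integral => t _ do rewrite gee0_abs ?marginal_ge0//.
rewrite -integral_marginal// setXTT; apply: le_lt_trans w_int _.
by rewrite ltry.
Qed.

(** Lebesgue differentiation applies to real-valued functions; the marginal,
    being integrable, is infinite on a null set only. *)
Let density (t : R) : R := fine (marginal t).

Lemma marginal_fin_ae (J : set (measurableTypeR R)) : measurable J ->
  (\int[mu]_(t in J) marginal t = \int[mu]_(t in J) (density t)%:E)%E.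
Proof.
move=> mJ; apply: ae_eq_integral => //.
- exact: measurable_funTS measurable_marginal.
- apply/measurable_EFinP; apply: measurable_funTS.
  by apply: measurableT_comp => //; exact: measurable_marginal.
- have := integrable_ae measurableT integrable_marginal.
  apply: filterS => t /(_ I) tG tI; rewrite /density fineK//; exact: tG.
Qed.

Lemma integrable_density (J : set (measurableTypeR R)) : measurable J ->
  mu.-integrable J (EFin \o density).
Proof.
move=> mJ; apply: (integrableS measurableT) => //.
apply: (le_integrable measurableT _ _ integrable_marginal).
  apply/measurable_EFinP.
  by apply: measurableT_comp => //; exact: measurable_marginal.
move=> t _ /=; rewrite /density; have := marginal_ge0 t.
by case: (marginal t) => [r|//|//] _ /=; rewrite ?normr0 ?lexx ?leey.
Qed.

(** Where the primitive of [density] has derivative [density t], the right-hand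
    side of [vertical_estimate] converges as [h] tends to 0, for all [y] at
    once. *)
Lemma stream_pointwise (M : R) : (forall t, `|mollifier t| <= M) ->
  {ae mu, forall t, - a <= t < a -> forall y, 0 < y < b ->
    psi (t, y) ^+ 2 <= M ^+ 2 * y ^+ 3 * density t}.
Proof.
move=> HM.
have lm : locally_integrable [set: R] density.
  by apply: open_integrable_locally; [exact: openT|exact: integrable_density].
have iNy y : mu.-integrable `]-oo, y] (EFin \o density).
  by apply: integrable_density; exact: measurable_itv.
pose F (x : R) : R := \int[mu]_(s in `]-oo, x]) density s.
have : {ae mu, forall t : R, derivable F t 1 /\ derive1 F t = density t}.
  exact: FTC1Ny iNy lm.
apply: filterS; first exact: (ae_filter_ringOfSetsType mu).
move=> t [dF Ft] tI y /andP[y0 yb].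
have /andP[at_ ta] := tI.
have cF : (F (t + h) - F t) / h @[h --> (0 : R)^'+] --> density t.
  rewrite -Ft derive1E.
  have -> : (fun h => (F (t + h) - F t) / h) =
      (fun h => h^-1 *: (F (h *: (1 : R) + t) - F t)).
    by apply/funext => h; rewrite /GRing.scale /= mulr1 mulrC [t + h]addrC.
  by apply: cvg_trans dF; apply: cvg_app; exact: at_right_sub_dnbhs.
have c0 := @delta_cvg _ _ (t, 0) cpsi (lexx 0).
have cy := @delta_cvg _ _ (t, y) cpsi (ltW y0).
have cid : (h : R) @[h --> (0 : R)^'+] --> (0 : R).
  exact: (@cvg_at_right_filter _ _ id 0 0 cvg_id).
have cyh : (y + h : R) @[h --> (0 : R)^'+] --> y.
  by rewrite -[X in _ --> X]addr0; apply: cvgD => //; exact: cvg_cst.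
have cyhh : (y + h + h : R) @[h --> (0 : R)^'+] --> y.
  by rewrite -[X in _ --> X]addr0; exact: cvgD.
have -> : psi (t, y) ^+ 2 = (extend_down psi (t, 0) - extend_down psi (t, y)) ^+ 2.
  by rewrite !extend_downE ?(ltW y0)//= stream_axis0// sub0r sqrrN.
have -> : M ^+ 2 * y ^+ 3 * density t = M ^+ 2 * y ^+ 2 * y * density t by ring.
pose I P h := \int[mu2]_(x in half_plane) (extend_down psi x * delta h P x).
have cL : (I (t, 0%R) h - I (t, y) h) ^+ 2 @[h --> (0 : R)^'+] -->
    (extend_down psi (t, 0) - extend_down psi (t, y)) ^+ 2.
  by apply: cvg_sqr; exact: cvgB.
have cR : M ^+ 2 * (y + h + h) ^+ 2 * (y + h) * ((F (t + h) - F t) / h)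
    @[h --> (0 : R)^'+] --> M ^+ 2 * y ^+ 2 * y * density t.
  by do 2 (apply: cvgM => //); apply: cvgM; [exact: cvg_cst|exact: cvg_sqr].
apply: (@ler_cvg_to R _ _ _ _ _ _ _ cL cR).
near=> h.
have h0 : 0 < h by near: h; exact: nbhs_right_gt.
apply: (vertical_estimate HM) => //.
- have : h < a - t by near: h; apply: nbhs_right_lt; lra.
  lra.
- lra.
- have : h < (b - y) / 2.
    by near: h; apply: nbhs_right_lt; rewrite divr_gt0// subr_gt0.
  lra.
rewrite integral_marginal; last exact: measurable_itv.
rewrite marginal_fin_ae; last exact: measurable_itv.
rewrite -integral_itv_obnd_cbnd; last first.
  exact: measurable_int (integrable_density (measurable_itv _)).
rewrite /F Rintegral_itvB//; last by rewrite bnd_simp lerDl ltW.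
rewrite fineK//; apply: integrable_fin_num => //.
exact: integrable_density (measurable_itv _).
Unshelve. all: by end_near.
Qed.

(** A measurable function on the plane whose integrals over vertical lines are
    the inner integrals to be bounded; by Tonelli these depend measurably on the
    first variable. *)
Let fibre_integrand x : R :=
  `|extend_down psi x| ^+ 2 * x.2 ^- 3 * \1_(setT `*` `[0, b]) x.

Lemma fibre_integrand_ge0 x : 0 <= fibre_integrand x.
Proof.
rewrite /fibre_integrand indicE; case: (boolP (x \in _)) => xb; last by rewrite mulr0.
move/set_mem : xb => [_ /=]; rewrite in_itv/= => /andP[x0 _].
by rewrite mulr1 mulr_ge0// invr_ge0 exprn_ge0.
Qed.

Lemma measurable_fibre_integrand : measurable_fun (setT : set plane) fibre_integrand.
Proof.
apply: measurable_funM.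
  apply: measurable_funM; last exact: measurable_pow_inv2.
  apply: measurable_funX; apply: measurableT_comp => //.
  exact: continuous_measurable_plane.
apply: measurable_indic; apply: measurableX => //; exact: measurable_itv.
Qed.

Lemma measurable_fibre t :
  measurable_fun (`]0, b[%classic : set (measurableTypeR R))
    (fun y => (`|psi (t, y)| ^+ 2 / y ^+ 3)%:E).
Proof.
apply/measurable_EFinP.
apply: (eq_measurable_fun (fun y => fibre_integrand (t, y))) => [y|].
  rewrite inE /= in_itv/= => /andP[y0 yb].
  rewrite /fibre_integrand indicE mem_set ?mulr1 ?extend_downE ?ltW//.
  by split => //; rewrite /= in_itv/= !ltW.
apply: measurable_funTS; apply: measurableT_comp; first exact: measurable_fibre_integrand.
exact: measurable_pair1.
Qed.

Lemma fibre_estimate (M t : R) :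
  (forall y, 0 < y < b -> psi (t, y) ^+ 2 <= M ^+ 2 * y ^+ 3 * density t) ->
  (\int[mu]_(y in `[0%R, b]) (`|psi (t, y)| ^+ 2 / y ^+ 3)%:E
    <= (M ^+ 2 * b * density t)%:E)%E.
Proof.
move=> psi_le.
have m0 : 0 <= density t by rewrite fine_ge0// marginal_ge0.
rewrite integral_itv_bndoo; last exact: measurable_fibre.
apply: (@le_trans _ _ (\int[mu]_(y in `]0%R, b[) (M ^+ 2 * density t)%:E)%E).
  apply: ge0_le_integral => //=.
  - move=> y; rewrite in_itv/= => /andP[y0 _].
    by rewrite lee_fin divr_ge0// ?exprn_ge0// ltW.
  - exact: measurable_fibre.
  - move=> y; rewrite in_itv/= => yb; have /andP[y0 _] := yb.
    rewrite lee_fin ler_pdivrMr ?exprn_gt0// real_normK ?num_real//.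
    by rewrite mulrAC psi_le.
rewrite integral_cst//.
rewrite /= lebesgue_measure_itv/= lte_fin b0 sube0 -EFinM lee_fin.
by rewrite mulrAC.
Qed.

Lemma fibre_integralE t :
  (\int[mu]_(y in `[0%R, b]) (`|psi (t, y)| ^+ 2 / y ^+ 3)%:E =
   \int[mu]_y (fibre_integrand (t, y))%:E)%E.
Proof.
rewrite integral_mkcond; apply: eq_integral => y _.
rewrite patchE /fibre_integrand indicE.
have -> : ((t, y) \in setT `*` [set` `[0, b]]) = (y \in [set` `[0, b]]).
  apply/idP/idP => [/set_mem[_ yb]|/set_mem yb]; first exact: mem_set yb.
  exact: mem_set.
case: ifPn => [/set_mem /=|_]; last by rewrite mulr0.
by rewrite in_itv/= => /andP[y0 _]; rewrite mulr1 extend_downE.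
Qed.

(** The endpoints of both intervals are null sets, so the almost everywhere
    bound inside the box suffices. *)
Lemma box_estimate (M : R) : (forall t, `|mollifier t| <= M) ->
  (\int[mu]_(t in `[(- a)%R, a])
     \int[mu]_(y in `[0%R, b]) (`|psi (t, y)| ^+ 2 / y ^+ 3)%:E
   <= (M ^+ 2 * b * A)%:E)%E.
Proof.
move=> HM; under eq_integral => t _ do rewrite fibre_integralE.
have mK : measurable_fun setT (fun t => \int[mu]_y (fibre_integrand (t, y))%:E)%E.
  apply: (@measurable_fun_fubini_tonelli_F _ _ _ _ _ mu (fun x => (fibre_integrand x)%:E)).
    by apply/measurable_EFinP; exact: measurable_fibre_integrand.
  by move=> x; rewrite lee_fin fibre_integrand_ge0.
have Mb0 : 0 <= M ^+ 2 * b by rewrite mulr_ge0 ?sqr_ge0// ltW.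
have m0 t : 0 <= density t by rewrite fine_ge0// marginal_ge0.
have mI : measurable (`](- a)%R, a[%classic : set (measurableTypeR R)).
  exact: measurable_itv.
rewrite integral_itv_bndoo//; last exact: measurable_funTS.
have mm : measurable_fun (`](- a)%R, a[%classic : set (measurableTypeR R)) (EFin \o density).
  exact: measurable_int (integrable_density mI).
apply: (@le_trans _ _ (\int[mu]_(t in `](- a)%R, a[) ((M ^+ 2 * b)%:E * (density t)%:E))%E).
  apply: ae_ge0_le_integral => //.
  - by move=> t _; apply: integral_ge0 => y _; rewrite lee_fin fibre_integrand_ge0.
  - exact: measurable_funTS.
  - by move=> t _; rewrite lee_fin mulr_ge0.
  - exact: measurable_funeM.
  - have := stream_pointwise HM; apply: filterS.
      exact: (ae_filter_ringOfSetsType mu).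
    move=> t Ht /=; rewrite in_itv/= => /andP[at_ ta]; rewrite -fibre_integralE -EFinM.
    by apply: fibre_estimate; apply: Ht; rewrite ltW.
rewrite ge0_integralZl//; last by move=> t _; rewrite lee_fin.
rewrite -marginal_fin_ae// -integral_marginal//.
rewrite [leRHS]EFinM lee_wpmul2l ?lee_fin//.
apply: le_trans w_int; apply: ge0_subset_integral => //.
- exact: measurableX.
- exact/measurable_EFinP.
- by move=> x _; rewrite lee_fin.
Qed.

End Box.

End Stream.

Section Density.
Context {R : realType}.
Local Notation plane := (measurableTypeR R * measurableTypeR R)%type.

Definition weighted_density (v : R * R -> R * R) (x : R * R) : R :=
  `|enorm (v x)| ^+ 2 * x.2 ^- 2.

Lemma weighted_densityE (v : R * R -> R * R) x :
  weighted_density v x = ((v x).1 ^+ 2 + (v x).2 ^+ 2) * x.2 ^- 2.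
Proof.
by rewrite /weighted_density real_normK ?num_real// sqr_sqrtr// addr_ge0 ?sqr_ge0.
Qed.

Lemma half_plane_measurable : measurable (half_plane : set plane).
Proof.
apply: open_measurable_plane.
rewrite (_ : half_plane = snd @^-1` [set t : R | 0 < t])//.
by apply: open_comp => [x _|]; [exact: cvg_snd|exact: open_gt].
Qed.

(** The functions [fst \o v] and [snd \o v] are measurable in the open half
    plane; on the axis the density vanishes because [0^-1 = 0]. *)
Lemma measurable_weighted_density (v : R * R -> R * R) (D : set plane) :
  L1loc (fst \o v) -> L1loc (snd \o v) -> measurable D ->
  D `<=` closed_half_plane ->
  measurable_fun setT (weighted_density v \_ D).
Proof.
move=> v1 v2 mD DH.
have mDH : measurable (D `&` half_plane : set plane).
  by apply: measurableI => //; exact: half_plane_measurable.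
rewrite (_ : _ \_ _ = weighted_density v \_ (D `&` half_plane)); last first.
  apply/funext => x; rewrite !patchE.
  case: ifPn => xD; case: ifPn => xDH //; last first.
    by move: xDH xD; rewrite !inE => -[xD _] /negP; rewrite inE.
  rewrite weighted_densityE; have x20 : x.2 = 0.
    apply/eqP; rewrite eq_le; apply/andP; split.
      rewrite leNgt; apply/negP => x0; move/negP: xDH; apply.
      by apply: mem_set; split => //; exact: set_mem.
    exact: DH (set_mem xD).
  by rewrite x20 expr0n/= invr0 mulr0.
apply/(measurable_restrictT _ mDH).
rewrite (_ : weighted_density v = fun x => ((v x).1 ^+ 2 + (v x).2 ^+ 2) * x.2 ^- 2).
  have sq (u : R * R -> R) : L1loc u ->
      measurable_fun (D `&` half_plane : set plane) (fun x => u x ^+ 2).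
    move=> /L1loc_measurable mu_; apply: measurable_funX.
    by apply: measurable_funS mu_; [exact: half_plane_measurable|].
  apply: measurable_funM; first by apply: measurable_funD; exact: sq.
  by apply: measurable_funTS; exact: measurable_pow_inv2.
by apply/funext => x; exact: weighted_densityE.
Qed.

End Density.

(** * The weighted estimate *)

(* The integrands contain x_2 ^- 3 and x_2 ^- 2, which the library sets to 0 at
   x_2 = 0: this only affects a null set. *)
Theorem lemma2p4 (R : realType) :
  exists N : R, 0 < N /\
    forall (a b : R) (v : R * R -> R * R) (psi : R * R -> R),
      0 < a -> 0 < b -> H1dot_0sigma v -> stream_function v psi ->
      ((\int[lebesgue_measure]_(x1 in `[(- a)%R, a])
          \int[lebesgue_measure]_(x2 in `[0%R, b])
            (`|psi (x1, x2)| ^+ 2 / x2 ^+ 3)%:E) `^ 2^-1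
       <= (N * b `^ 2^-1)%:E *
          wL2norm (`[(- a)%R, a] `*` `[0%R, b]) (fun x => (x.2 ^- 2)%R)
            (fun x => enorm (v x)))%E.
Proof.
have [M M0 HM] := @mollifier_bounded R.
exists M; split => // a b v psi a0 b0 [g1 [g2 [[v1 _ _ _] [v2 _ _ _] _]]] psi_v.
pose Q := rect (- a) a 0 b.
have mQ := @measurable_rect _ (- a) a 0 b.
have QH : Q `<=` closed_half_plane by move=> x [_ /=]; rewrite in_itv/= => /andP[].
pose w := weighted_density v \_ Q.
have w0 x : 0 <= w x.
  rewrite /w patchE; case: ifP => // _.
  by rewrite /weighted_density mulr_ge0 ?sqr_ge0// invr_ge0 sqr_ge0.
have mw := measurable_weighted_density v1 v2 mQ QH.
pose A := (\int[lebesgue_measure \x lebesgue_measure]_(x in Q) (weighted_density v x)%:E)%E.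
rewrite [wL2norm _ _ _](_ : _ = (A `^ 2^-1)%E)//.
have A0 : (0 <= A)%E.
  apply: integral_ge0 => x _; rewrite lee_fin.
  by rewrite mulr_ge0 ?sqr_ge0// invr_ge0 sqr_ge0.
have AE : A = (\int[lebesgue_measure \x lebesgue_measure]_x (w x)%:E)%E.
  by rewrite /A integral_mkcond; apply: eq_integral => x _; rewrite /w !patchE; case: ifP.
have Nb0 : 0 < M * b `^ 2^-1 by rewrite mulr_gt0// powR_gt0.
have [Afin|] := boolP (A \is a fin_num); last first.
  (* An infinite right-hand side. *)
  rewrite ge0_fin_numE// ltey negbK => /eqP ->.
  by rewrite poweRyr ?invr_eq0// gt0_muley ?lte_fin// leey.
have w_ge x : rect (- a) a 0 b x -> 0 < x.2 ->
    (v x).1 ^+ 2 * x.2 ^- 2 <= w x /\ (v x).2 ^+ 2 * x.2 ^- 2 <= w x.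
  move=> xQ x0; rewrite /w patchE mem_set// weighted_densityE mulrDl.
  have x2V0 : 0 <= x.2 ^- 2 by rewrite invr_ge0 sqr_ge0.
  by split; rewrite ?lerDl ?lerDr; apply: mulr_ge0 => //; exact: sqr_ge0.
have w_int : (\int[lebesgue_measure \x lebesgue_measure]_x (w x)%:E <= (fine A)%:E)%E.
  by rewrite -AE fineK.
have le := box_estimate a0 b0 psi_v v1 v2 mw w0 w_ge w_int HM.
apply: (@le_trans _ _ (((M ^+ 2 * b)%:E * A) `^ 2^-1)%E).
  apply: gt0_ler_poweR.
  - by rewrite invr_ge0.
  - rewrite in_itv/= leey andbT; apply: integral_ge0 => t _.
    apply: integral_ge0 => y /=; rewrite in_itv/= => /andP[y0 _].
    by rewrite lee_fin divr_ge0// ?exprn_ge0.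
  - rewrite in_itv/= leey andbT mule_ge0// lee_fin mulr_ge0 ?sqr_ge0//.
    exact: ltW.
  - by rewrite -(fineK Afin) -EFinM.
rewrite poweRM//; last by rewrite lee_fin mulr_ge0 ?sqr_ge0// ltW.
rewrite poweR_EFin powRM ?sqr_ge0//; last exact: ltW.
have -> : (M ^+ 2) `^ 2^-1 = M.
  by rewrite powR12_sqrt ?sqr_ge0// sqrtr_sqr gtr0_norm.
exact: lexx.
Qed.
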